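(* Let $p$ be an odd prime and let $u\in\mathbb{Z}_p$ with $u\not\equiv \frac 14\pmod p$. Then $$\sum_{n=0}^{p-1}A_nu^n \equiv\sum_{k=0}^{p-1}\binom{2k}k^2\binom{3k}k\Big(\frac{u^2}{(1-4u)^3}\Big)^k\pmod p,$$ where $A_n=\sum_{k=0}^n\binom{2k}k\binom{2n-2k}{n-k}\binom nk^2$.
   Context: For a prime $p$, $\mathbb{Z}_p$ denotes the set of rational numbers whose denominator is not divisible by $p$; congruences modulo $p$ are taken in $\mathbb{Z}_p$. *)

(* Defs.v *)
From mathcomp Require Import all_boot all_order all_algebra.
Set Implicit Arguments.
Unset Strict Implicit.
Unset Printing Implicit Defensive.
Import GRing.Theory Num.Theory.
Local Open Scope ring_scope.

(* [Zloc p] is the ring of rationals whose (reduced) denominator is prime to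
   the prime p, i.e. the localization of the integers at p, not the ring of
   p-adic integers, nor the residue ring ['Z_p]. *)
Definition Zloc (p : nat) : {pred rat} := [pred x | ~~ (p %| `|denq x|)%N].

(* x = y modulo the ideal p Zloc(p) of Zloc(p); both sides are required to lie
   in Zloc(p). *)
Definition Zloc_eqmod (p : nat) (x y : rat) : Prop :=
  [/\ x \in Zloc p, y \in Zloc p & exists2 z, z \in Zloc p & x - y = p%:R * z].

Definition A (n : nat) : nat :=
  (\sum_(k < n.+1) 'C(2 * k, k) * 'C(2 * n - 2 * k, n - k) * 'C(n, k) ^ 2)%N.

(* Main.v *)
Require Import Defs.
From mathcomp Require Import all_boot all_order all_algebra.
From mathcomp Require Import finfield ring zify.
Set Implicit Arguments.
Unset Strict Implicit.
Unset Printing Implicit Defensive.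
Import GRing.Theory Num.Theory.
Local Open Scope ring_scope.

(* With [c_k = 'C(2k, k)^2 'C(3k, k)], the Domb numbers satisfy
   [A n = sum_k c_k 'C(n + k, 3k) 4^(n - 2k)], because both sides obey the
   recurrence [(n+2)^3 a_(n+2) = 2(2n+3)(5n^2+15n+12) a_(n+1) - 64(n+1)^3 a_n]
   (proved on each side by telescoping with an explicit certificate).
   Modulo p, [c_k] vanishes for [p/3 <= k < p], and for [s = 3k < p] the
   reflection ['C(m + s, s) = (-1)^m 'C(p-1-s, m)] turns the truncated series
   [sum_m 'C(m + s, s) x^m] into [(1 - x)^(p-1-s)], which is [(1 - x)^(-s)] by
   Fermat.  Everything modulo p takes place in ['F_p], reached from [Zloc p]
   by [ratr]. *)

(** * Falling factorials of ring elements, which may be negative or residues *)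

Definition falling (R : pzRingType) (x : R) (m : nat) : R :=
  \prod_(i < m) (x - i%:R).

Lemma fallingSr (R : pzRingType) (x : R) (m : nat) :
  falling x m.+1 = falling x m * (x - m%:R).
Proof. by rewrite /falling big_ord_recr. Qed.

Lemma fallingSl (R : pzRingType) (x : R) (m : nat) :
  falling x m.+1 = x * falling (x - 1) m.
Proof.
rewrite /falling big_ord_recl subr0; congr (_ * _); apply: eq_bigr => i _.
by rewrite /bump /= natrD opprD addrA.
Qed.

Lemma natr_ffact (R : pzRingType) (n m : nat) :
  (n ^_ m)%:R = falling (n%:R : R) m.
Proof.
elim: m => [|m IHm]; first by rewrite ffactn0 /falling big_ord0.
rewrite fallingSr -IHm ffactnSr natrM; case: (leqP m n) => [le_mn | lt_nm].
  by rewrite natrB.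
by rewrite ffact_small // !mul0r.
Qed.

Lemma natr_bin_fact (R : pzRingType) (n m : nat) :
  'C(n, m)%:R * m`!%:R = falling (n%:R : R) m.
Proof. by rewrite -natr_ffact -bin_ffact natrM. Qed.

(** * The Domb recurrence for [A] *)

Lemma central_binS (k : nat) :
  (k.+1%:R : rat) * 'C(2 * k.+1, k.+1)%:R = 2 * (2 * k%:R + 1) * 'C(2 * k, k)%:R.
Proof.
have E j : ('C(2 * j, j)%:R : rat) = (2 * j)`!%:R / j`!%:R ^+ 2.
  have := @bin_fact (2 * j) j.
  rewrite mul2n -addnn leq_addr addnK => /(_ isT) <-.
  by rewrite !natrM; field; rewrite pnatr_eq0 -lt0n fact_gt0.
rewrite !E mulnS !factS !natrM -!natr1 natrM; field.
by rewrite !natr1 !pnatr_eq0 -!lt0n fact_gt0.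
Qed.

(** Since ['C(n, k)] is a quotient of factorials, [A n] divided by the squared factorial of [n] is
    the self-convolution of this sequence. *)
Definition domb_weight (k : nat) : rat := 'C(2 * k, k)%:R / k`!%:R ^+ 2.

Lemma domb_weightS (k : nat) :
  k.+1%:R ^+ 3 * domb_weight k.+1 = 2 * (2 * k%:R + 1) * domb_weight k.
Proof.
rewrite /domb_weight factS natrM.
have -> : 'C(2 * k.+1, k.+1)%:R =
  2 * (2 * k%:R + 1) * 'C(2 * k, k)%:R / (k.+1%:R : rat).
  by rewrite -central_binS; field; rewrite nat1r pnatr_eq0.
by field; rewrite ?(natr1, nat1r) !pnatr_eq0 -!lt0n fact_gt0.
Qed.

Definition domb_conv (n : nat) : rat :=
  \sum_(k < n.+1) domb_weight k * domb_weight (n - k).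

Lemma natr_A (n : nat) : (A n)%:R = n`!%:R ^+ 2 * domb_conv n.
Proof.
rewrite /A /domb_conv natr_sum mulr_sumr; apply: eq_bigr => -[k /= lt_kn] _.
rewrite -mulnBr natrM natrX natrM -(@bin_fact n k) // /domb_weight !natrM; field.
by rewrite !pnatr_eq0 -!lt0n !fact_gt0.
Qed.

(** Parity argument; it lets [field] clear the denominators [2 * y - 1] and [2 * y - 3] below. *)
Lemma double_sub_odd_neq0 (y : nat) (c : rat) (m : nat) : c = 2 * m%:R + 1 ->
  2 * (y%:R : rat) - c != 0.
Proof.
move=> ->; rewrite subr_eq0 -natrM -(natrM _ 2) natr1 eqr_nat.
by apply/eqP; lia.
Qed.

(** A Zeilberger-style certificate: the closed form of the partial sums of [domb_summand n]. The
    factor [x ^+ 3] makes it vanish at [k = 0]. *)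
Definition domb_certificate (n k : nat) : rat :=
  let x : rat := k%:R in let m : rat := n%:R in
  let q := 4 * x ^+ 3 - (18 * m + 30) * x ^+ 2
           + (26 * m ^+ 2 + 89 * m + 74) * x
           - (12 * m ^+ 3 + 62 * m ^+ 2 + 104 * m + 56) in
  x ^+ 3 * q / (2 * (n.+2 - k)%:R - 1)
  * domb_weight k * domb_weight (n.+2 - k).

(* The summand of the recurrence for [domb_conv]: the multipliers rewrite the
   convolution terms of index [n + 1] and [n] in terms of the one of index
   [n + 2], and vanish exactly where the shorter sums stop. *)
Definition domb_summand (n k : nat) : rat :=
  let y : rat := (n.+2 - k)%:R in let m : rat := n%:R in
  ((m + 2) ^+ 5 - (2 * m + 3) * (5 * m ^+ 2 + 15 * m + 12) * y ^+ 3 / (2 * y - 1)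
   + 16 * (m + 1) * y ^+ 3 * (y - 1) ^+ 3 / ((2 * y - 1) * (2 * y - 3)))
  * domb_weight k * domb_weight (n.+2 - k).

Lemma domb_telescope (n K : nat) : (K <= n.+2)%N ->
  \sum_(k < K) domb_summand n k = domb_certificate n K.
Proof.
elim: K => [|k IHk] le_kn.
  by rewrite big_ord0 /domb_certificate expr0n !mul0r.
rewrite big_ord_recr /= IHk; last exact: ltnW.
rewrite /domb_certificate /domb_summand.
(* Setting [n.+2 - k = j.+1] removes the truncated subtraction. Both sides become rational functions
   of [k] and [j] times [domb_weight k * domb_weight j.+1]. *)
have [j Ej] : exists j, (n.+2 - k = j.+1)%N by exists (n.+1 - k)%N; lia.
have Ej' : (n.+2 - k.+1 = j)%N by lia.
have En : (n%:R : rat) = k%:R + j%:R - 1.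
  by apply/(addIr 1); rewrite subrK natr1 -natrD; congr _%:R; lia.
rewrite Ej Ej' En /=.
have Hk := domb_weightS k; have Hj := domb_weightS j.
have odd1 : 2 * (j%:R : rat) - 1 != 0 by apply: (@double_sub_odd_neq0 j 1 0); ring.
have odd3 : 2 * (j%:R : rat) + 1 != 0 by rewrite -natrM natr1 pnatr_eq0.
have Wj : domb_weight j = j.+1%:R ^+ 3 * domb_weight j.+1 / (2 * (2 * j%:R + 1)).
  by rewrite Hj; field.
have Wk : domb_weight k.+1 = 2 * (2 * k%:R + 1) * domb_weight k / k.+1%:R ^+ 3.
  by rewrite -Hk; field; rewrite nat1r pnatr_eq0.
rewrite Wj Wk -!natr1; field.
by rewrite odd3 odd1 natr1 pnatr_eq0.
Qed.

Lemma domb_summand_sum0 (n : nat) : \sum_(k < n.+3) domb_summand n k = 0.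
Proof.
(* The last term, at [k = n.+2], has [y = 0] and reduces to its [(m + 2) ^+ 5] part, which cancels
   the certificate there. *)
rewrite big_ord_recr /= domb_telescope // /domb_certificate /domb_summand subnn.
have -> : (n.+2%:R : rat) = n%:R + 2 by rewrite -natrD addn2.
by field.
Qed.

(** Lengthens a convolution by one term, which is zero because [h] vanishes at 0; convolutions of
    different lengths can then be compared termwise. *)
Lemma conv_shift (R : pzRingType) (f g h : nat -> R) (n : nat) :
    h 0%N = 0 -> (forall j, h j.+1 = g j) ->
  \sum_(k < n.+1) f k * g (n - k)%N = \sum_(k < n.+2) f k * h (n.+1 - k)%N.
Proof.
move=> h0 hS; rewrite [RHS]big_ord_recr /= subnn h0 mulr0 addr0.
by apply: eq_bigr => -[k /= lt_kn] _; rewrite subSn // hS.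
Qed.

Lemma domb_conv_rec (n : nat) :
  (n%:R + 2) ^+ 5 * domb_conv n.+2
  - 2 * (2 * n%:R + 3) * (5 * n%:R ^+ 2 + 15 * n%:R + 12) * domb_conv n.+1
  + 64 * (n%:R + 1) * domb_conv n = 0.
Proof.
(* By [domb_weightS], [h1] and [h2] are the weight sequence delayed by one and by two places,
   written as multiples of [domb_weight y]. *)
pose h1 (y : nat) : rat := y%:R ^+ 3 / (2 * (2 * y%:R - 1)) * domb_weight y.
pose h2 (y : nat) : rat := y%:R ^+ 3 * (y%:R - 1) ^+ 3
   / (4 * (2 * y%:R - 1) * (2 * y%:R - 3)) * domb_weight y.
have h10 : h1 0%N = 0 by rewrite /h1 expr0n !mul0r.
have h20 : h2 0%N = 0 by rewrite /h2 expr0n !mul0r.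
have odd1 y : 2 * (y%:R : rat) - 1 != 0 by apply: (@double_sub_odd_neq0 y 1 0); ring.
have odd3 y : 2 * (y%:R : rat) - 3 != 0 by apply: (@double_sub_odd_neq0 y 3 1); ring.
have odd1' y : 2 * (y%:R : rat) + 1 != 0 by rewrite -natrM natr1 pnatr_eq0.
have h1S j : h1 j.+1 = domb_weight j.
  have -> : domb_weight j = j.+1%:R ^+ 3 * domb_weight j.+1 / (2 * (2 * j%:R + 1)).
    by rewrite domb_weightS; field.
  by rewrite /h1 -natr1; field; rewrite odd1'.
have h2S j : h2 j.+1 = h1 j.
  rewrite /h1; have -> : domb_weight j =
      j.+1%:R ^+ 3 * domb_weight j.+1 / (2 * (2 * j%:R + 1)).
    by rewrite domb_weightS; field.
  by rewrite /h2 -natr1; field; rewrite ?odd1' ?odd1.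
rewrite {2 3}/domb_conv (conv_shift domb_weight n.+1 h10 h1S).
rewrite (conv_shift domb_weight n h10 h1S) (conv_shift domb_weight n.+1 h20 h2S).
rewrite -[RHS](domb_summand_sum0 n) /domb_conv.
rewrite !mulr_sumr -sumrB -big_split /=; apply: eq_bigr => k _.
rewrite /h1 /h2 /domb_summand; field.
by rewrite odd1 odd3.
Qed.

Lemma A_rec (n : nat) :
  (n%:R + 2) ^+ 3 * (A n.+2)%:R =
  2 * (2 * n%:R + 3) * (5 * n%:R ^+ 2 + 15 * n%:R + 12) * (A n.+1)%:R
  - 64 * (n%:R + 1) ^+ 3 * (A n)%:R :> rat.
Proof.
have /eqP := domb_conv_rec n; rewrite addr_eq0 subr_eq => /eqP E.
rewrite !natr_A !factS !natrM.
have -> : (n.+2%:R : rat) = n%:R + 2 by rewrite -natrD addn2.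
rewrite -natr1.
have -> (a b c d : rat) : a ^+ 3 * ((a * (b * c)) ^+ 2 * d) =
  (b * c) ^+ 2 * (a ^+ 5 * d) by ring.
by rewrite E; ring.
Qed.

(** * The expansion of [A n] in the coefficients [hyp_coef k] *)

Definition hyp_weight (k : nat) : rat := 'C(2 * k, k)%:R / (k`!%:R ^+ 3 * 16 ^+ k).

(** For [n < N] this is [A n / 4 ^+ n]: [hyp_weight k] is [hyp_coef k] over [16 ^+ k] times the
    factorial of [3 * k]. Taking out [4 ^+ n] avoids the truncated exponent [n - 2 * k]. *)
Definition hyp_sum (n N : nat) : rat :=
  \sum_(k < N) hyp_weight k * falling ((n + k)%:R) (3 * k).

Lemma hyp_weightS (k : nat) :
  8 * k.+1%:R ^+ 4 * hyp_weight k.+1 = (2 * k%:R + 1) * hyp_weight k.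
Proof.
rewrite /hyp_weight factS natrM (exprS _ k).
have -> : 'C(2 * k.+1, k.+1)%:R =
  2 * (2 * k%:R + 1) * 'C(2 * k, k)%:R / (k.+1%:R : rat).
  by rewrite -central_binS; field; rewrite nat1r pnatr_eq0.
have p16 : (16 : rat) ^+ k != 0 by rewrite expf_eq0 pnatr_eq0 andbF.
by field; rewrite p16 ?(natr1, nat1r) !pnatr_eq0 -!lt0n fact_gt0.
Qed.

(** The recurrence of [A_rec], rescaled by powers of 4, holds for truncated sums up to the boundary
    term on the right, which vanishes once [n < 2 * N]. *)
Lemma hyp_sum_telescope (n N : nat) :
  2 * (n%:R + 2) ^+ 3 * hyp_sum n.+2 N.+1
  - (2 * n%:R + 3) * (5 * n%:R ^+ 2 + 15 * n%:R + 12) * hyp_sum n.+1 N.+1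
  + 8 * (n%:R + 1) ^+ 3 * hyp_sum n N.+1
  = - 24 * (3 * n%:R + 4) * N.+1%:R ^+ 4 * hyp_weight N.+1
    * falling ((n + N.+1)%:R) (3 * N + 1).
Proof.
have f0 (x : rat) : falling x 0 = 1 by rewrite /falling big_ord0.
have E k : hyp_weight k.+1 = (2 * k%:R + 1) * hyp_weight k / (8 * k.+1%:R ^+ 4).
  by rewrite -hyp_weightS; field; rewrite nat1r pnatr_eq0.
elim: N => [|N IHN].
  rewrite /hyp_sum !big_ord_recr !big_ord0 /= !muln0 !addn0 E !f0 addn1.
  by rewrite fallingSr f0 /hyp_weight -natr1; field.
move: IHN; rewrite /hyp_sum; set M := N.+1 => IHN.
rewrite !(big_ord_recr M) /=.
have -> (a b c d e f x y z : rat) : a * (x + d) - b * (y + e) + c * (z + f)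
  = (a * x - b * y + c * z) + (a * d - b * e + c * f) by ring.
rewrite IHN (E M) /M.
(* [Q] is common to the three new summands and to the new boundary term: each falling factorial
   extends it by two or three factors at its ends. *)
set Q := falling _ (3 * N + 1)%N.
have -> : falling ((n.+2 + N.+1)%:R : rat) (3 * N.+1) =
    (n%:R + N%:R + 3) * (n%:R + N%:R + 2) * Q.
  have -> : (3 * N.+1 = (3 * N + 1).+2)%N by lia.
  rewrite !fallingSl /Q mulrA; congr (_ * _ * falling _ _);
  by rewrite ?natrD -!natr1; ring.
have -> : falling ((n.+1 + N.+1)%:R : rat) (3 * N.+1) =
    (n%:R + N%:R + 2) * Q * (n%:R - 2 * N%:R).
  have -> : (3 * N.+1 = (3 * N + 1).+2)%N by lia.
  rewrite fallingSl fallingSr /Q mulrA; congr (_ * falling _ _ * _);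
  by rewrite ?(natrD, natrM) -?natr1; ring.
have -> : falling ((n + N.+1)%:R : rat) (3 * N.+1) =
    Q * (n%:R - 2 * N%:R) * (n%:R - 2 * N%:R - 1).
  have -> : (3 * N.+1 = (3 * N + 1).+2)%N by lia.
  rewrite 2!fallingSr /Q; congr (_ * _ * _);
  by rewrite ?(natrD, natrM) -?natr1; ring.
have -> : falling ((n + N.+2)%:R : rat) (3 * N.+1 + 1) =
    (n%:R + N%:R + 2) * (Q * (n%:R - 2 * N%:R) * (n%:R - 2 * N%:R - 1)).
  have -> : (3 * N.+1 + 1 = (3 * N + 1).+3)%N by lia.
  rewrite fallingSl 2!fallingSr /Q.
  have -> : ((n + N.+2)%:R - 1 : rat) = (n + N.+1)%:R by rewrite addnS -natr1 addrK.
  by congr (_ * (_ * _ * _)); rewrite ?(natrD, natrM) -?natr1; ring.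
rewrite -!natr1; field.
by rewrite !natr1 pnatr_eq0.
Qed.

Lemma falling_small (R : pzRingType) (n m : nat) :
  (n < m)%N -> falling (n%:R : R) m = 0.
Proof. by move=> lt_nm; rewrite -natr_ffact ffact_small. Qed.

(** The extra terms have [n < k], hence [n + k < 3 * k], and their falling factorials contain a zero
    factor. *)
Lemma hyp_sum_widen (n N : nat) : (n < N)%N -> hyp_sum n N = hyp_sum n n.+1.
Proof.
pose F k := hyp_weight k * falling ((n + k)%:R) (3 * k).
move=> lt_nN; rewrite /hyp_sum (big_ord_widen N F lt_nN) [RHS]big_mkcond.
apply: eq_bigr => k _; case: ltnP => // le_nk.
by rewrite falling_small ?mulr0 //; lia.
Qed.

Lemma A_hyp_sum (n : nat) : (A n)%:R = 4 ^+ n * hyp_sum n n.+1.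
Proof.
(* The recurrence has order two, so the induction carries two consecutive values. *)
suff: (A n)%:R = 4 ^+ n * hyp_sum n n.+1
   /\ (A n.+1)%:R = 4 ^+ n.+1 * hyp_sum n.+1 n.+2 by case.
have f0 (x : rat) : falling x 0 = 1 by rewrite /falling big_ord0.
elim: n => [|n [IHn IHn1]].
  split; rewrite /A /hyp_sum !big_ord_recr !big_ord0 /= /hyp_weight.
    by rewrite !f0.
  by rewrite !f0 falling_small // mulr0.
split=> //; have n2_neq0 : (n%:R + 2 : rat) ^+ 3 != 0.
  by rewrite expf_eq0 -natrD addn2 pnatr_eq0.
apply: (mulfI n2_neq0); rewrite A_rec IHn IHn1.
have := hyp_sum_telescope n n.+2.
rewrite (@falling_small _ (n + n.+3)) ?mulr0; last by lia.
rewrite (@hyp_sum_widen n.+1 n.+3) // (@hyp_sum_widen n n.+3) //; last by lia.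
move=> E; rewrite !exprS; apply/eqP; rewrite -subr_eq0; apply/eqP.
by rewrite -[RHS](mulr0 (- (8 * 4 ^+ n))) -E; ring.
Qed.

Definition hyp_coef (k : nat) : nat := ('C(2 * k, k) ^ 2 * 'C(3 * k, k))%N.

(** Used twice: to pass from [hyp_weight] to [hyp_coef], and to see which [hyp_coef k] are divisible
    by [p]. *)
Lemma hyp_coef_fact (k : nat) :
  (hyp_coef k * k`! ^ 3 = 'C(2 * k, k) * (3 * k)`!)%N.
Proof.
have := @bin_fact (2 * k) k; have := @bin_fact (3 * k) k.
have -> : (3 * k - k = 2 * k)%N by lia.
have -> : (2 * k - k = k)%N by lia.
move=> /(_ ltac:(lia)) <- /(_ ltac:(lia)) <-; rewrite /hyp_coef; ring.
Qed.

(** The free bound [N] allows the same range for all [n < p], so that the double sum can be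
    exchanged. *)
Lemma A_sum_hyp (n N : nat) : (n < N)%N ->
  A n = (\sum_(k < N) hyp_coef k * ('C(n + k, 3 * k) * 4 ^ (n - 2 * k)))%N.
Proof.
move=> lt_nN; apply/eqP; rewrite -(eqr_nat rat) A_hyp_sum -(hyp_sum_widen lt_nN).
rewrite natr_sum /hyp_sum mulr_sumr; apply/eqP/eq_bigr => -[k /= _] _.
(* When [n < 2 * k] the exponent [n - 2 * k] is truncated to 0, but the binomial coefficient
   vanishes. *)
rewrite -natr_bin_fact; have [lt_nk | le_kn] := ltnP n (2 * k).
  by rewrite bin_small ?mul0r ?mulr0 ?muln0 ?mul0n ?muln0 //; lia.
have /(congr1 (fun m => m%:R : rat)) := hyp_coef_fact k.
rewrite (natrM _ (hyp_coef k)) natrX natrM => E.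
have k3 : (k`!%:R : rat) ^+ 3 != 0 by rewrite expf_eq0 pnatr_eq0 -lt0n fact_gt0.
rewrite -[X in 4 ^+ X](subnKC le_kn) exprD exprM.
have -> : (4 ^+ 2 = 16 :> rat) by [].
rewrite (natrM _ (hyp_coef k)) natrM natrX.
have -> : (hyp_coef k)%:R = 'C(2 * k, k)%:R * (3 * k)`!%:R / (k`!%:R : rat) ^+ 3.
  by rewrite -E mulfK.
have p16 : (16 : rat) ^+ k != 0 by rewrite expf_eq0 pnatr_eq0 andbF.
rewrite /hyp_weight; field.
by rewrite p16 pnatr_eq0 -lt0n fact_gt0.
Qed.

(** * Identities in a field of characteristic [p] *)

Section CharP.

Variables (F : fieldType) (p : nat) (pcharFp : p \in [pchar F]).

Let p_prime : prime p. Proof. exact: (pcharf_prime pcharFp). Qed.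

Lemma natf_neq0_small (n : nat) : (0 < n < p)%N -> (n%:R : F) != 0.
Proof.
by case/andP=> n0 np; rewrite -(dvdn_pcharf pcharFp) gtnNdvd.
Qed.

Lemma factf_neq0 (n : nat) : (n < p)%N -> (n`!%:R : F) != 0.
Proof.
elim: n => [|n IHn] lt_np; first by rewrite oner_eq0.
by rewrite factS natrM mulf_neq0 ?IHn ?natf_neq0_small //; lia.
Qed.

Lemma fact_pchar0 (n : nat) : (p <= n)%N -> (n`!%:R : F) = 0.
Proof.
move=> le_pn; apply/eqP; rewrite -(dvdn_pcharf pcharFp).
by apply: dvdn_fact; rewrite prime_gt0.
Qed.

(** The factors [m + s, ..., s + 1] are listed in reverse order, each with its sign changed. *)
Lemma falling_reflect (s m : nat) :
  falling ((m + s)%:R : F) m = (-1) ^+ m * falling (- 1 - s%:R) m.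
Proof.
elim: m => [|m IHm]; first by rewrite /falling !big_ord0 mulr1.
rewrite fallingSl fallingSr exprS.
have -> : ((m.+1 + s)%:R - 1 : F) = (m + s)%:R by rewrite -natr1 addrK.
by rewrite IHm addSn -natr1 natrD; ring.
Qed.

(** In characteristic [p] the argument [- 1 - s] of [falling_reflect] equals [p - 1 - s]; the
    factorial of [m] is invertible because [m < p]. *)
Lemma bin_reflect (s m : nat) : (s < p)%N -> (m < p)%N ->
  'C(m + s, s)%:R = (-1) ^+ m * 'C(p - 1 - s, m)%:R :> F.
Proof.
move=> lt_sp lt_mp; apply: (mulIf (factf_neq0 lt_mp)).
rewrite -mulrA natr_bin_fact -{1}(addnK m (m + s)%N) -[X in 'C(_, X)](addKn m s).
rewrite addnK bin_sub ?leq_addr // natr_bin_fact falling_reflect.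
congr (_ * falling _ _).
by rewrite -subnDA natrB ?add1n // (pcharf0 pcharFp) -natr1; ring.
Qed.

(** The binomial theorem after reflection. The bound [p - s <= N] keeps every nonzero term; [N <= p]
    keeps [m < p], as reflection requires. *)
Lemma sum_bin_geom (s N : nat) (x : F) : (s < p)%N -> (p - s <= N <= p)%N ->
  \sum_(m < N) 'C(m + s, s)%:R * x ^+ m = (1 - x) ^+ (p - 1 - s).
Proof.
move=> lt_sp /andP[le_psN le_Np].
have le1 : ((p - 1 - s).+1 <= N)%N by lia.
pose T i := ((-1) ^+ i * 1 ^+ (p - 1 - s - i) * x ^+ i) *+ 'C(p - 1 - s, i).
rewrite exprBn (big_ord_widen N T le1) [RHS]big_mkcond.
apply: eq_bigr => -[m /= lt_mN] _.
rewrite bin_reflect //; last exact: leq_trans lt_mN le_Np.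
case: ltnP => [_ | le_m]; first by rewrite /T expr1n -mulr_natr; ring.
by rewrite bin_small ?mulr0 ?mul0r.
Qed.

(** In [hyp_coef_fact], [p] divides the factorial of [3 * k] but not that of [k]. *)
Lemma hyp_coef_pchar0 (k : nat) : (k < p <= 3 * k)%N -> (hyp_coef k)%:R = 0 :> F.
Proof.
case/andP=> lt_kp le_p3k; have /(congr1 (fun m => m%:R : F)) := hyp_coef_fact k.
rewrite (natrM _ (hyp_coef k)) natrX natrM (fact_pchar0 le_p3k) mulr0 => /eqP.
by rewrite mulf_eq0 expf_eq0 (negbTE (factf_neq0 lt_kp)) andbF orbF => /eqP.
Qed.

Lemma sum_hyp_term (k : nat) (v : F) : (3 * k < p)%N ->
  \sum_(n < p) ('C(n + k, 3 * k) * 4 ^ (n - 2 * k))%N%:R * v ^+ n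
  = (v ^+ 2) ^+ k * (1 - 4%:R * v) ^+ (p - 1 - 3 * k).
Proof.
move=> lt_3kp; have le2kp : (2 * k <= p)%N by lia.
(* The terms with [n < 2 * k] vanish; the substitution [n = m + 2 * k] leaves the series of
   [sum_bin_geom] with [s = 3 * k], at [4 * v]. *)
rewrite -(big_mkord xpredT (fun n => ('C(n + k, 3 * k) * 4 ^ (n - 2 * k))%N%:R * v ^+ n)).
rewrite (big_cat_nat (n := 2 * k)) //= big_nat_cond big1 ?add0r; last first.
  by move=> n /andP[/andP[_ lt_n] _]; rewrite bin_small ?mul0r //; lia.
rewrite -[in LHS](add0n (2 * k)%N) big_addn big_mkord -exprM.
rewrite -(@sum_bin_geom _ (p - 2 * k)); [|lia|lia].
rewrite mulr_sumr; apply: eq_bigr => -[m /= _] _.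
rewrite addnK natrM natrX exprMn exprD.
have -> : (m + 2 * k + k = m + 3 * k)%N by lia.
ring.
Qed.

Lemma sum_A_pchar (v : F) : 1 - 4%:R * v != 0 ->
    (1 - 4%:R * v) ^+ (p - 1) = 1 ->
  \sum_(n < p) (A n)%:R * v ^+ n =
  \sum_(k < p) (hyp_coef k)%:R * (v ^+ 2 / (1 - 4%:R * v) ^+ 3) ^+ k.
Proof.
move=> w_neq0 w_fermat.
transitivity (\sum_(n < p) \sum_(k < p) (hyp_coef k)%:R *
    (('C(n + k, 3 * k) * 4 ^ (n - 2 * k))%N%:R * v ^+ n)).
  apply: eq_bigr => n _; rewrite (A_sum_hyp (ltn_ord n)) natr_sum mulr_suml.
  by apply: eq_bigr => k _; rewrite natrM mulrA.
rewrite exchange_big; apply: eq_bigr => -[k /= lt_kp] _; rewrite -mulr_sumr.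
have [lt_3kp | le_p3k] := ltnP (3 * k) p; last first.
  by rewrite hyp_coef_pchar0 ?lt_kp // !mul0r.
rewrite sum_hyp_term // expr_div_n; congr (_ * (_ * _)); rewrite -exprM.
(* Multiplying by the power [3 * k] completes the exponent to [p - 1], where [w_fermat] applies. *)
apply: (mulIf (expf_neq0 (3 * k) w_neq0)).
by rewrite mulVf ?expf_neq0 // -exprD subnK //; lia.
Qed.

End CharP.

(** * Reduction from [Zloc p] to ['F_p] *)

Section Reduction.

Variables (p : nat) (p_prime : prime p).

Let pcharFp : p \in [pchar 'F_p]. Proof. exact: pchar_Fp. Qed.

Lemma intr_Fp_eq0 (a : int) : ((a%:~R : 'F_p) == 0) = (p %| `|a|)%N.
Proof.
rewrite (dvdn_pcharf pcharFp); case: a => n //=.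
by rewrite NegzE mulrNz oppr_eq0.
Qed.

Lemma ZlocP (x : rat) : (x \in Zloc p) = ((denq x)%:~R != 0 :> 'F_p).
Proof. by rewrite intr_Fp_eq0. Qed.

(** [ratr] into ['F_p] is not multiplicative on all of [rat] and is computed from the reduced
    fraction. Here any fraction with denominator prime to [p] may be used, since the reduced
    denominator divides it; compatibility with the ring operations follows. *)
Lemma Zloc_frac (x : rat) (a b : int) : (b%:~R : 'F_p) != 0 ->
  x * b%:~R = a%:~R -> x \in Zloc p /\ ratr x = a%:~R / b%:~R :> 'F_p.
Proof.
move=> b_neq0 xb.
have E : numq x * b = a * denq x.
  have dx : (denq x)%:~R != 0 :> rat by rewrite intr_eq0 denq_eq0.
  apply/(@intr_inj rat); rewrite !intrM -xb -{2}[x]divq_num_den; field.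
  exact: dx.
have d_dvd : (denq x %| b)%Z.
  rewrite -(@Gauss_dvdzr _ (numq x)); first by rewrite E dvdz_mull.
  by rewrite coprimezE coprime_sym coprime_num_den.
have d_neq0 : (denq x)%:~R != 0 :> 'F_p.
  case/dvdzP: d_dvd => c bE; apply: contra b_neq0 => /eqP d0.
  by rewrite bE intrM d0 mulr0.
split; first by rewrite ZlocP.
rewrite /ratr; apply/eqP; rewrite eqr_div //.
by rewrite -!intrM E.
Qed.

Lemma Zloc_fracE (x : rat) : x \in Zloc p ->
  [/\ (denq x)%:~R != 0 :> 'F_p, x * (denq x)%:~R = (numq x)%:~R
    & ratr x = (numq x)%:~R / (denq x)%:~R :> 'F_p].
Proof.
rewrite ZlocP => d_neq0; split=> //.
by rewrite -{1}[x]divq_num_den divfK // intr_eq0 denq_eq0.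
Qed.

Lemma Zloc_nat (n : nat) : n%:R \in Zloc p /\ ratr n%:R = n%:R :> 'F_p.
Proof.
have := @Zloc_frac n%:R n 1 (oner_neq0 _); rewrite mulr1 divr1.
by apply.
Qed.

Lemma ZlocD (x y : rat) : x \in Zloc p -> y \in Zloc p ->
  x + y \in Zloc p /\ ratr (x + y) = ratr x + ratr y :> 'F_p.
Proof.
move=> /Zloc_fracE[dx Ex ->] /Zloc_fracE[dy Ey ->].
have [||-> ->] := @Zloc_frac (x + y)
  (numq x * denq y + numq y * denq x) (denq x * denq y).
- by rewrite intrM mulf_neq0.
- by rewrite intrD !intrM -Ex -Ey; ring.
by split=> //; rewrite intrD !intrM; field; rewrite dx dy.
Qed.

Lemma ZlocM (x y : rat) : x \in Zloc p -> y \in Zloc p ->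
  x * y \in Zloc p /\ ratr (x * y) = ratr x * ratr y :> 'F_p.
Proof.
move=> /Zloc_fracE[dx Ex ->] /Zloc_fracE[dy Ey ->].
have [||-> ->] := @Zloc_frac (x * y) (numq x * numq y) (denq x * denq y).
- by rewrite intrM mulf_neq0.
- by rewrite !intrM -Ex -Ey; ring.
by split=> //; rewrite !intrM; field; rewrite dx dy.
Qed.

Lemma ZlocN (x : rat) : x \in Zloc p ->
  - x \in Zloc p /\ ratr (- x) = - ratr x :> 'F_p.
Proof.
move=> /Zloc_fracE[dx Ex ->].
have [|-> ->] := @Zloc_frac (- x) (- numq x) (denq x) dx.
  by rewrite mulNr Ex mulrNz.
by split=> //; rewrite mulrNz mulNr.
Qed.

Lemma ZlocV (x : rat) : x \in Zloc p -> ratr x != 0 :> 'F_p ->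
  x^-1 \in Zloc p /\ ratr x^-1 = (ratr x)^-1 :> 'F_p.
Proof.
move=> /Zloc_fracE[dx Ex ->]; rewrite mulf_eq0 invr_eq0 negb_or => /andP[nx _].
have [|-> ->] := @Zloc_frac x^-1 (denq x) (numq x) nx; last by rewrite invf_div.
have x_neq0 : x != 0.
  by apply: contraNneq nx => ->.
by rewrite -Ex mulKf.
Qed.

Lemma ZlocX (x : rat) (n : nat) : x \in Zloc p ->
  x ^+ n \in Zloc p /\ ratr (x ^+ n) = ratr x ^+ n :> 'F_p.
Proof.
move=> xZ; elim: n => [|n [IHn En]]; first exact: (Zloc_nat 1).
by rewrite !exprS -En; apply: ZlocM.
Qed.

Lemma Zloc_sum (n : nat) (f : nat -> rat) : (forall i, f i \in Zloc p) ->
  \sum_(i < n) f i \in Zloc p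
  /\ ratr (\sum_(i < n) f i) = \sum_(i < n) ratr (f i) :> 'F_p.
Proof.
move=> fZ; elim: n => [|n [IHn En]].
  by rewrite !big_ord0; apply: (Zloc_nat 0).
by rewrite !big_ord_recr /= -En; apply: ZlocD.
Qed.

(** The kernel of reduction is [p] times [Zloc p]: [p] divides the numerator of [x - y], and the
    quotient over the same denominator is the witness. *)
Lemma Zloc_eqmodP (x y : rat) : x \in Zloc p -> y \in Zloc p ->
  ratr x = ratr y :> 'F_p -> Zloc_eqmod p x y.
Proof.
move=> xZ yZ eq_xy; split=> //.
have [nyZ Eny] := ZlocN yZ; have [dZ Ed] := ZlocD xZ nyZ.
have [d_neq0 Exy Er] := Zloc_fracE dZ.
have /eqP : ratr (x - y) = 0 :> 'F_p by rewrite Ed Eny eq_xy subrr.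
rewrite Er mulf_eq0 invr_eq0 (negbTE d_neq0) orbF intr_Fp_eq0.
move=> /(@dvdzP p) [c Ec].
exists (c%:~R / (denq (x - y))%:~R).
  have [] // := @Zloc_frac (c%:~R / (denq (x - y))%:~R) c (denq (x - y)) d_neq0.
  by rewrite divfK // intr_eq0 denq_eq0.
by rewrite -{1}[x - y]divq_num_den Ec intrM mulrCA mulrA.
Qed.

End Reduction.

Theorem theorem3p1 (p : nat) (u : rat)
    (p_prime : prime p) (p_odd : odd p)
    (u_int : u \in Zloc p) (u_neq : ~ Zloc_eqmod p u (1 / 4%:R)) :
  Zloc_eqmod p
    (\sum_(n < p) (A n)%:R * u ^+ n)
    (\sum_(k < p) ('C(2 * k, k) ^ 2 * 'C(3 * k, k))%N%:R
                  * (u ^+ 2 / (1 - 4%:R * u) ^+ 3) ^+ k).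
Proof.
(* Oddness of [p] makes 4 invertible, so [1 / 4] lies in [Zloc p]. *)
have four_neq0 : 4%:R != 0 :> 'F_p.
  rewrite -(dvdn_pcharf (pchar_Fp p_prime)) -[4%N]/(2 ^ 2)%N Euclid_dvdX //.
  by rewrite andbT dvdn_prime2 //; apply: contraTneq p_odd => ->.
have [Z1 E1] := Zloc_nat p_prime 1; have [Z4 E4] := Zloc_nat p_prime 4.
have [Z4u E4u] := ZlocM p_prime Z4 u_int.
have [ZN EN] := ZlocN p_prime Z4u; have [Zw Ew] := ZlocD p_prime Z1 ZN.
have {}Ew : ratr (1 - 4%:R * u) = 1 - 4%:R * ratr u :> 'F_p.
  by rewrite Ew EN E4u E1 E4.
(* If [1 - 4 * u] reduced to 0, then [u] would be congruent to [1 / 4]. *)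
have w_neq0 : ratr (1 - 4%:R * u) != 0 :> 'F_p.
  apply/eqP => w0; apply: u_neq.
  have [Z4i E4i] := ZlocV p_prime Z4 (etrans (congr1 (fun x => x != 0) E4) four_neq0).
  apply: Zloc_eqmodP => //; rewrite ?div1r // E4i E4.
  apply: (mulfI four_neq0); rewrite mulfV //; apply/esym/eqP.
  by rewrite -subr_eq0 -Ew w0.
have [Zw3 Ew3] := ZlocX p_prime 3 Zw.
have [|Zi Ei] := ZlocV p_prime Zw3; first by rewrite Ew3 expf_neq0.
have [Zu2 Eu2] := ZlocX p_prime 2 u_int.
have [Zr Er] := ZlocM p_prime Zu2 Zi.
have HL n := ZlocM p_prime (Zloc_nat p_prime (A n)).1 (ZlocX p_prime n u_int).1.
have HR k := ZlocM p_prime (Zloc_nat p_prime (hyp_coef k)).1 (ZlocX p_prime k Zr).1.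
have [ZL EL] := Zloc_sum p_prime p (fun n => (HL n).1).
have [ZR ER] := Zloc_sum p_prime p (fun n => (HR n).1).
apply: Zloc_eqmodP => //; rewrite EL ER.
under eq_bigr => n _ do
  rewrite (HL n).2 (Zloc_nat p_prime (A n)).2 (ZlocX p_prime n u_int).2.
under [RHS]eq_bigr => k _ do
  rewrite (HR k).2 (Zloc_nat p_prime _).2 (ZlocX p_prime k Zr).2 Er Eu2 Ei Ew3 Ew.
rewrite Ew in w_neq0; apply: (sum_A_pchar (pchar_Fp p_prime)) => //.
(* Fermat: [w ^+ p = w] in ['F_p], with one factor [w] cancelled. *)
apply: (mulfI w_neq0); rewrite -exprS mulr1 subn1 prednK ?prime_gt0 //.
by have := expf_card (1 - 4%:R * ratr u : 'F_p); rewrite card_Fp.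
Qed.
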